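(* Let $n\ge 1$ and let $D$ be an oriented graph of order $n$ belonging to $\mathcal{F}_n$. Then $D$ has at most $2^k-1$ generalized cospectral mates (counted up to isomorphism), where $k$ is the number of distinct odd prime factors of $\det W(D)$.
   Context: An oriented graph $D$ on vertices $v_1,\dots,v_n$ is a digraph obtained from a simple undirected graph by giving each edge one direction. Its skew-adjacency matrix $S(D)=(s_{ij})$ is the $n\times n$ matrix with $s_{ij}=1$ if $(v_i,v_j)$ is an arc, $s_{ij}=-1$ if $(v_j,v_i)$ is an arc, and $s_{ij}=0$ otherwise. Let $e$ be the all-ones column vector of length $n$ and $J$ the $n\times n$ all-ones matrix. The skew-walk matrix of $D$ is $W(D)=[e,\,S(D)e,\,S(D)^2e,\dots,S(D)^{n-1}e]$. The quantity $2^{-\lfloor n/2\rfloor}\det W(D)$ is always an integer; $\mathcal{F}_n$ denotes the set of oriented graphs $D$ of order $n$ for which $2^{-\lfloor n/2\rfloor}\det W(D)$ is an odd square-free integer. Two oriented graphs $D,C$ of order $n$ share the same generalized skew spectrum if $S(D)$ and $S(C)$ have the same eigenvalues (with multiplicities) and $J-S(D)$ and $J-S(C)$ have the same eigenvalues (with multiplicities). Two oriented graphs are isomorphic if there is a bijection of vertex sets mapping arcs to arcs (with direction) in both directions. A generalized cospectral mate of $D$ is an oriented graph not isomorphic to $D$ that shares the same generalized skew spectrum with $D$. *)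

(* Defs.v *)
From HB Require Import structures.
From mathcomp Require Import all_boot all_order all_algebra all_fingroup all_field.

Set Implicit Arguments.
Unset Strict Implicit.
Unset Printing Implicit Defensive.

Import Order.TTheory GRing.Theory Num.Theory.
Local Open Scope ring_scope.

(* Taking i = j shows that loops are excluded as well. *)
Definition oriented n (A : {set 'I_n * 'I_n}) : bool :=
  [forall i, forall j, ((i, j) \in A) ==> ((j, i) \notin A)].

Record ograph n := OGraph {
  arcs : {set 'I_n * 'I_n};
  arcs_oriented : oriented arcs
}.

HB.instance Definition _ n := [isSub for @arcs n].
HB.instance Definition _ n := [Finite of ograph n by <:].

Definition arc n (D : ograph n) (i j : 'I_n) : bool := (i, j) \in arcs D.

Definition skew_adj n (D : ograph n) : 'M[int]_n :=
  \matrix_(i, j) (if arc D i j then 1 else if arc D j i then -1 else 0).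

Definition ones n : 'cV[int]_n := const_mx 1.

Definition allones_mx n : 'M[int]_n := const_mx 1.

Definition skew_walk n (D : ograph n) : 'M[int]_n :=
  \matrix_(i < n, j < n) (skew_adj D ^+ j *m ones n) i 0.

Definition squarefree (m : int) : Prop :=
  forall d : int, (d ^+ 2 %| m)%Z -> d \is a GRing.unit.

(* The quotient is formed in rat, and m is its value as an integer. *)
Definition in_F n (D : ograph n) : Prop :=
  exists m : int,
    [/\ (\det (skew_walk D))%:~R / 2 ^+ n./2 = m%:~R :> rat,
        ~~ (2 %| m)%Z & squarefree m].

(* The complex eigenvalues of an integer matrix, listed with their algebraic
   multiplicities in an unspecified order; they are algebraic numbers, so algC
   suffices. *)
Definition eigenvalues n (A : 'M[int]_n) : seq algC :=
  sval (closed_field_poly_normal (char_poly (map_mx intr A : 'M[algC]_n))).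

Lemma char_poly_eigenvalues n (A : 'M[int]_n) :
  char_poly (map_mx intr A : 'M[algC]_n) =
    \prod_(z <- eigenvalues A) ('X - z%:P).
Proof.
rewrite /eigenvalues; case: closed_field_poly_normal => r /= {1}->.
by rewrite (monicP (char_poly_monic _)) scale1r.
Qed.

Definition same_gen_skew_spectrum n (D C : ograph n) : bool :=
  perm_eq (eigenvalues (skew_adj D)) (eigenvalues (skew_adj C)) &&
  perm_eq (eigenvalues (allones_mx n - skew_adj D))
          (eigenvalues (allones_mx n - skew_adj C)).

Definition oisom n (D C : ograph n) : bool :=
  [exists s : {perm 'I_n}, forall i, forall j, arc D i j == arc C (s i) (s j)].

Definition gen_cospectral_mates n (D : ograph n) : {set ograph n} :=
  [set C | ~~ oisom C D & same_gen_skew_spectrum C D].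

Definition isom_class n (C : ograph n) : {set ograph n} := [set C' | oisom C C'].

Definition num_odd_prime_factors (m : int) : nat :=
  size [seq p <- primes `|m|%N | odd p].

(* Main.v *)
(* Write e for the all-ones vector, W for the walk matrix of D and d = det W. If C has
   the same generalized skew spectrum as D, then the numbers e^T S^k e agree, hence
   W(C)^T W(C) = W^T W and Q = W(C) W^-1 is a rational orthogonal matrix that fixes e and
   intertwines S(D) and S(C). An integral such Q is a permutation matrix. For two mates
   C1 and C2 with matrices Q1 and Q2, it is therefore enough that R = Q1 Q2^T be integral
   at every prime p.
   - If p does not divide d, both Q1 and Q2 are integral at p.
   - If p = 2, let g be a monic polynomial of degree ceil(n/2) with g^2 = phi or x phi
     mod 2, phi being the characteristic polynomial of S. Mod 2 the matrix M = g(S) is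
     symmetric with zero square, and so M e = diag(M^2) = 0. Replacing the columns S^j e
     of W, for j >= ceil(n/2), by S^(j - ceil(n/2)) g(S) e / 2 gives an integral matrix of
     odd determinant, by the same rational column operations for D and C; hence Q is
     integral at 2.
   - If p is odd and divides d, then p^2 does not, and mod p the rows of p Q1 and p Q2
     all lie on the line of row vectors killed by W. When neither is zero mod p, this line
     is isotropic, and as p is odd, isotropy mod p^2 determines the two lifts
     well enough to make R integral at p.
   So the class of C is determined by the set of odd primes p dividing d at which Q is
   not integral, and this set is empty only for the class of D. *)
Require Import Defs.
From mathcomp Require Import all_boot all_order all_algebra all_fingroup all_field.
From mathcomp Require Import ring zify.

Set Implicit Arguments.
Unset Strict Implicit.
Unset Printing Implicit Defensive.

Import Order.TTheory GRing.Theory Num.Theory.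
Local Open Scope ring_scope.

(** * Moments of a matrix from characteristic polynomials *)

(** Matrix determinant lemma, with the adjugate for the inverse. The bordered matrix [M] is
    eliminated in two ways; the second introduces a factor [\det A], which is then cancelled. *)
Lemma det_sub_rank1 (R : idomainType) n (A : 'M[R]_n) (u : 'cV_n) (v : 'rV_n) :
  \det A != 0 -> \det (A - u *m v) = \det A - (v *m \adj A *m u) 0 0.
Proof.
move=> dA0; pose M := block_mx A u v 1%:M.
have detM : \det M = \det (A - u *m v).
  have -> : M = block_mx (A - u *m v) u 0 1%:M *m block_mx 1%:M 0 v 1%:M.
    by rewrite mulmx_block !mulmx1 !mul1mx !mulmx0 ?mul0mx !add0r subrK.
  by rewrite det_mulmx det_ublock det_lblock !det1 !mulr1.
have dM : block_mx 1%:M 0 (- (v *m \adj A)) (\det A)%:M *m M =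
    block_mx A u 0 ((\det A)%:M - v *m \adj A *m u).
  rewrite mulmx_block !mul1mx !mul0mx !addr0 mulmx1 !mulNmx [_ + (\det A)%:M]addrC.
  by rewrite -[v *m \adj A *m A]mulmxA mul_adj_mx -scalar_mxC addNr.
have /(mulfI dA0) <- // : \det A * \det M = \det A * (\det A - (v *m \adj A *m u) 0 0).
have := congr1 determinant dM.
rewrite det_mulmx det_lblock det_ublock det1 mul1r det_scalar1 => ->.
by rewrite det_mx11 !mxE eqxx.
Qed.

Lemma size_det_leq (R : idomainType) n (A : 'M[{poly R}]_n) :
  (forall i j, size (A i j) <= 2)%N -> (size (\det A) <= n.+1)%N.
Proof.
move=> sA; apply: leq_trans (size_sum _ _ _) _; apply/bigmax_leqP => s _.
rewrite size_Msign; apply: leq_trans (size_prod_leq _ _) _.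
rewrite leq_subLR card_ord addnS ltnS.
have -> : (n + n = \sum_(i < n) 2)%N by rewrite sum_nat_const card_ord muln2 addnn.
exact: leq_sum.
Qed.

Lemma size_adj_char_poly_mx (R : idomainType) n (A : 'M[R]_n) i j :
  (size (\adj (char_poly_mx A) i j) <= n)%N.
Proof.
case: n A i j => [|n] A i j; first by case: i.
rewrite mxE size_Msign; apply: size_det_leq => k l; rewrite !mxE.
apply: leq_trans (size_polyD _ _) _.
rewrite geq_max size_polyN size_polyC; apply/andP; split; last by case: eqP.
by case: (_ == _); rewrite ?mulr1n ?size_polyX ?mulr0n ?size_poly0.
Qed.

(* Both sides are coefficients of a Laurent expansion of the entry of the resolvent,
   [v (X - A)^-1 u], which is read off the two characteristic polynomials;
   the truncated geometric sum avoids Laurent series. *)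
Lemma moments_char_poly (R : idomainType) n (A B : 'M[R]_n.+1) (u : 'cV_n.+1)
    (v : 'rV_n.+1) :
  char_poly A = char_poly B -> char_poly (A + u *m v) = char_poly (B + u *m v) ->
  forall k, v *m A ^+ k *m u = v *m B ^+ k *m u.
Proof.
pose liftu := map_mx polyC u; pose liftv := map_mx polyC v.
pose r (C : 'M[R]_n.+1) := (liftv *m \adj (char_poly_mx C) *m liftu) 0 0.
have charD C : char_poly (C + u *m v) = char_poly C - r C.
  rewrite /char_poly -det_sub_rank1; last exact: monic_neq0 (char_poly_monic C).
  by rewrite /char_poly_mx map_mxD map_mxM opprD addrA.
pose w (C : 'M[R]_n.+1) k := (v *m C ^+ k *m u) 0 0.
pose t (C : 'M[R]_n.+1) N :=
  (liftv *m (\adj (char_poly_mx C) *m map_mx polyC (C ^+ N)) *m liftu) 0 0.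
have geom C N : char_poly C * \sum_(k < N) 'X^(N.-1 - k) * (w C k)%:P =
    'X^N * r C - t C N.
  pose a := char_poly_mx C; pose b := map_mx polyC C; pose x : 'M_n.+1 := 'X%:M.
  have E : 'X^N *: \adj a - \adj a *m map_mx polyC (C ^+ N) =
      char_poly C *: \sum_(k < N) 'X^(N.-1 - k) *: map_mx polyC (C ^+ k).
    rewrite rmorphXn /= -/b -mul_mx_scalar rmorphXn -mulmxBr /=.
    rewrite subrXX_comm; last exact: (esym (scalar_mxC _ _)).
    rewrite mulmxA mul_adj_mx mul_scalar_mx; congr (_ *: _).
    by apply: eq_bigr => k _; rewrite -mul_scalar_mx ![in RHS]rmorphXn.
  have := congr1 (fun M => (liftv *m M *m liftu) 0 0) E.
  rewrite mulmxBr mulmxBl -scalemxAr -scalemxAl -scalemxAr -scalemxAl.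
  rewrite mxE [X in X + _]mxE [X in _ + X]mxE [RHS]mxE => ->.
  rewrite mulmx_sumr mulmx_suml summxE; congr (_ * _); apply: eq_bigr => k _.
  by rewrite -scalemxAr -scalemxAl [RHS]mxE -!map_mxM /= [X in _ = _ * X]mxE.
have size_t C N : (size (t C N) <= n.+1)%N.
  rewrite /t mulmxA -mulmxA -map_mxM /= mxE.
  apply: leq_trans (size_sum _ _ _) _; apply/bigmax_leqP => i _.
  rewrite [X in _ * X]mxE mulrC mul_polyC (leq_trans (size_scale_leq _ _)) // mxE.
  apply: leq_trans (size_sum _ _ _) _; apply/bigmax_leqP => j _.
  rewrite [X in X * _]mxE mul_polyC (leq_trans (size_scale_leq _ _)) //.
  exact: size_adj_char_poly_mx.
clearbody r t; move=> eAB eABuv k.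
have /addrI/oppr_inj rAB : char_poly A - r A = char_poly A - r B.
  by rewrite -charD eABuv charD eAB.
pose q := \sum_(i < k.+1) 'X^(k - i) * (w A i - w B i)%:P.
have eq_q : char_poly A * q = t B k.+1 - t A k.+1.
  have -> : q = \sum_(i < k.+1) 'X^(k - i) * (w A i)%:P -
                \sum_(i < k.+1) 'X^(k - i) * (w B i)%:P.
    by rewrite -sumrB; apply: eq_bigr => i _; rewrite polyCB mulrBr.
  by rewrite mulrBr geom eAB geom rAB opprB addrC addrA subrK.
(* A nonzero [q] would give a product of size at least [n.+2], whereas the remainders [t] have size
   at most [n.+1]. The constant coefficient of [q] is the difference of the moments of order [k]. *)
have q0 : q = 0.
  apply/eqP/negPn/negP => nz_q.
  have : (size (t B k.+1 - t A k.+1)%R <= n.+1)%N.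
    by rewrite (leq_trans (size_polyD _ _)) // geq_max size_polyN !size_t.
  rewrite -eq_q (size_monicM (char_poly_monic A) nz_q) size_char_poly addSn /=.
  by move: nz_q; rewrite -size_poly_gt0 -(ltn_add2l n.+1) addn0 ltnNge => /negPf ->.
have /eqP := congr1 (fun p : {poly R} => p`_0) q0.
rewrite coef0 /q coef_sum big_ord_recr /= big1 => [|i _]; last first.
  by rewrite coefMC coefXn eq_sym subn_eq0 leqNgt ltn_ord mul0r.
rewrite add0r subnn expr0 mul1r coefC eqxx subr_eq0 => /eqP wk.
by apply/matrixP => i j; rewrite !ord1.
Qed.

(** * Cancellation rules, walk matrices and their Gram matrices *)

Lemma scale_mx_inj (R : idomainType) m n (a : R) :
  a != 0 -> injective (fun A : 'M[R]_(m, n) => a *: A).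
Proof.
move=> a0 A B /matrixP eAB; apply/matrixP => i j.
by have := eAB i j; rewrite !mxE; apply: mulfI.
Qed.

Lemma mulmx_det_injr (R : idomainType) m n (A : 'M[R]_n) :
  \det A != 0 -> injective (fun B : 'M[R]_(m, n) => B *m A).
Proof.
move=> A0 B C /(congr1 (mulmx^~ (\adj A))); rewrite -!mulmxA mul_mx_adj !mul_mx_scalar.
exact: scale_mx_inj.
Qed.

(** Stated for any integer matrix; [skew_walk D] is convertible to [walk_mx (skew_adj D)]. *)
Definition walk_mx n (S : 'M[int]_n.+1) : 'M[int]_n.+1 :=
  \matrix_(i, j) (S ^+ j *m ones n.+1) i 0.

Lemma col_walk_mx n (S : 'M[int]_n.+1) j : col j (walk_mx S) = S ^+ j *m ones n.+1.
Proof. by apply/matrixP => i k; rewrite [k]ord1 !mxE. Qed.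

Lemma char_poly_trmx (R : comNzRingType) n (A : 'M[R]_n) : char_poly A^T = char_poly A.
Proof. by rewrite /char_poly -det_tr /char_poly_mx linearB /= tr_scalar_mx -map_trmx trmxK. Qed.

(** As [S^T = - S], the entries of the Gram matrix are, up to sign, the moments e^T (-S)^(i+j) e. As
    J = e e^T, the matrix J - S is a rank-one perturbation of -S, so [moments_char_poly] applies. *)
Lemma skew_walk_gram n (S T : 'M[int]_n.+1) :
  S^T = - S -> T^T = - T -> char_poly S = char_poly T ->
  char_poly (allones_mx n.+1 - S) = char_poly (allones_mx n.+1 - T) ->
  (walk_mx S)^T *m walk_mx S = (walk_mx T)^T *m walk_mx T.
Proof.
move=> skS skT eST eJST; pose e := ones n.+1.
have JE : allones_mx n.+1 = e *m e^T.
  by apply/matrixP => i j; rewrite !mxE big_ord1 !mxE mulr1.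
have moment k : e^T *m (- S) ^+ k *m e = e^T *m (- T) ^+ k *m e.
  apply: moments_char_poly; first by rewrite -skS -skT !char_poly_trmx.
  by rewrite -JE ![- _ + _]addrC.
have gram (A : 'M_n.+1) i j : A^T = - A ->
    ((walk_mx A)^T *m walk_mx A) i j = (-1) ^+ j * (e^T *m (- A) ^+ (i + j) *m e) 0 0.
  move=> skA; have -> : ((walk_mx A)^T *m walk_mx A) i j =
      (((col i (walk_mx A))^T) *m col j (walk_mx A)) 0 0.
    by rewrite !mxE; apply: eq_bigr => k _; rewrite !mxE.
  rewrite !col_walk_mx trmx_mul mulmxA -[_ *m _ *m A ^+ j]mulmxA.
  have -> : (A ^+ i)^T = (- A) ^+ i.
    by elim: (val i) => [|k IH]; rewrite ?trmx1 // exprS trmx_mul IH skA [RHS]exprSr.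
  have -> : A ^+ j = (-1) ^+ j *: (- A) ^+ j by rewrite -exprZn scaleN1r opprK.
  by rewrite -!scalemxAr -scalemxAl mxE exprD.
by apply/matrixP => i j; rewrite (gram S i j skS) (gram T i j skT) moment.
Qed.

(** * The integral matrix [N], equal to d Q *)

Section Transport.
Variables (n : nat) (S T : 'M[int]_n.+1).
Let e := ones n.+1.
Let W := walk_mx S.
Let d := \det W.
Let N := walk_mx T *m \adj W.
Hypothesis d0 : d != 0.
Hypothesis eST : char_poly S = char_poly T.

(** For powers below the order this is [N *m W = d *: walk_mx T], read column by column; reduction
    modulo the common characteristic polynomial, by Cayley-Hamilton, gives the rest. *)
Lemma transport_horner (p : {poly int}) :
  N *m (horner_mx S p *m e) = d *: (horner_mx T p *m e).
Proof.
have NW : N *m W = d *: walk_mx T.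
  by rewrite /N -mulmxA mul_adj_mx mul_mx_scalar.
have NX k : (k < n.+1)%N -> N *m (S ^+ k *m e) = d *: (T ^+ k *m e).
  move=> lt_k; have := congr1 (col (Ordinal lt_k)) NW.
  by rewrite linearZ /= colE -mulmxA -colE !col_walk_mx.
have low (r : {poly int}) : (size r <= n.+1)%N ->
    N *m (horner_mx S r *m e) = d *: (horner_mx T r *m e).
  move=> sr; rewrite -[r]coefK poly_def !raddf_sum /= !mulmx_suml mulmx_sumr scaler_sumr.
  apply: eq_bigr => i _; rewrite !linearZ /= !rmorphXn /= !horner_mx_X -!scalemxAl.
  by rewrite -scalemxAr NX ?(leq_trans (ltn_ord i)) // scalerA mulrC -scalerA.
rewrite (Pdiv.RingMonic.rdivp_eq (char_poly_monic S) p) !rmorphD !rmorphM /=.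
have -> : horner_mx T (char_poly S) = 0 by rewrite eST Cayley_Hamilton.
rewrite Cayley_Hamilton !mulr0 !add0r low //.
by rewrite -ltnS -(size_char_poly S) Pdiv.Ring.ltn_rmodpN0 // monic_neq0 ?char_poly_monic.
Qed.

(** Both sides are compared on the columns of [W]. The last column leads to a power of [S] outside
    [W], which [transport_horner] covers. *)
Lemma transport_intertwines : N *m S = T *m N.
Proof.
have NX k : N *m (S ^+ k *m e) = d *: (T ^+ k *m e).
  by have := transport_horner 'X^k; rewrite !rmorphXn /= !horner_mx_X.
apply: (mulmx_det_injr d0); apply/matrixP => i j.
have colE (A : 'M_n.+1) : (A *m W) i j = (A *m (S ^+ j *m e)) i 0.
  by rewrite -col_walk_mx !mxE; apply: eq_bigr => k _; rewrite !mxE.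
rewrite !colE -(mulmxA N S) -(mulmxA T N).
have powS (A : 'M[int]_n.+1) : A *m (A ^+ j *m e) = A ^+ j.+1 *m e by rewrite mulmxA exprS.
by rewrite powS !NX -scalemxAr powS.
Qed.

Lemma transport_ones : N *m e = d *: e.
Proof. by have := transport_horner 1; rewrite !rmorph1 !mul1mx. Qed.

Hypothesis gramST : W^T *m W = (walk_mx T)^T *m walk_mx T.

Lemma transport_trmxM : N^T *m N = (d ^+ 2)%:M.
Proof.
rewrite /N trmx_mul mulmxA -(mulmxA _ _ (walk_mx T)) -gramST mulmxA -trmx_mul mul_mx_adj.
by rewrite -mulmxA mul_mx_adj tr_scalar_mx -scalar_mxM expr2.
Qed.

Lemma transportM_trmx : N *m N^T = (d ^+ 2)%:M.
Proof.
have N0 : \det N != 0.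
  apply/eqP => N0; have /eqP := congr1 determinant transport_trmxM.
  by rewrite det_mulmx N0 mulr0 det_scalar eq_sym !expf_eq0 (negPf d0).
by apply: (mulmx_det_injr N0); rewrite -mulmxA transport_trmxM scalar_mxC.
Qed.

Lemma transport_trmx_ones : N^T *m e = d *: e.
Proof.
apply: (scale_mx_inj d0); rewrite scalemxAr -{1}transport_ones mulmxA transport_trmxM.
by rewrite mul_scalar_mx scalerA expr2.
Qed.
End Transport.

(** * Integrality at 2 *)

Lemma coef_comp_polyNX (R : comNzRingType) (p : {poly R}) k :
  (p \Po (- 'X))`_k = (-1) ^+ k * p`_k.
Proof.
elim/poly_ind: p k => [|p c IHp] k; first by rewrite comp_poly0 !coef0 mulr0.
rewrite comp_polyD comp_polyM comp_polyX comp_polyC mulrN !coefD coefN !coefMX !coefC.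
by case: k => [|k] /=; rewrite ?oppr0 ?mul1r ?addr0 ?expr0 ?mul1r // IHp exprS mulN1r mulNr.
Qed.

(** Transposition turns det(X - S) into det(X + S), so the characteristic polynomial has the parity
    of [n]. *)
Lemma coef_char_poly_skew n (S : 'M[int]_n) k :
  S^T = - S -> odd k != odd n -> (char_poly S)`_k = 0.
Proof.
move=> skS kn; have: char_poly S \Po (- 'X) = (-1) ^+ n * char_poly S.
  rewrite -[in RHS]char_poly_trmx skS /char_poly -det_map_mx /= -detZ.
  congr determinant; apply/matrixP => i j; rewrite !mxE.
  by rewrite rmorphB rmorphMn /= comp_polyX comp_polyC polyCN mulN1r opprB mulNrn addrC.
move/(congr1 (fun p : {poly int} => p`_k)); rewrite coef_comp_polyNX.
rewrite -(signr_odd _ k) -(signr_odd _ n).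
case: (odd k) kn; case: (odd n) => //= _; rewrite ?expr0 ?expr1 ?mul1r ?mulN1r ?coefN.
  by move/eqP; rewrite eqNr => /eqP.
by move/esym/eqP; rewrite eqNr => /eqP.
Qed.

Lemma sqr_polyF2 (p : {poly 'F_2}) : p ^+ 2 = p \Po 'X^2.
Proof.
elim/poly_ind: p => [|p c IHp]; first by rewrite comp_poly0 expr0n.
have two0 : (2 : {poly 'F_2}) = 0 by rewrite -polyC_natr pchar_Fp_0.
have cc : c ^+ 2 = c by case: c => -[|[|]] // lt; apply: val_inj.
rewrite comp_polyD comp_polyM comp_polyX comp_polyC -IHp sqrrD -mulr_natl two0 mul0r addr0.
by rewrite exprMn -polyC_exp cc.
Qed.

Lemma sqr_even_polyF2 (h : {poly 'F_2}) :
  (forall i, odd i -> h`_i = 0) -> even_poly h ^+ 2 = h.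
Proof.
move=> h_odd; rewrite sqr_polyF2; apply/polyP => i.
rewrite coef_comp_poly_Xn // coef_even_poly dvdn2 divn2; case: ifP => [|/negbFE] oi.
  by rewrite even_halfK.
by rewrite h_odd.
Qed.

(** Every element of F_2 is its own square, so the row sums of a symmetric [M] are the diagonal
    entries of M^2. *)
Lemma F2_sym_sqr0 n (M : 'M['F_2]_n) : M^T = M -> M *m M = 0 -> M *m const_mx 1 = 0 :> 'cV_n.
Proof.
move=> symM M2; apply/colP => i; have M2ii : (M *m M) i i = 0 by rewrite M2 mxE.
rewrite [RHS]mxE -[RHS]M2ii !mxE; apply: eq_bigr => j _; rewrite -{3}symM !mxE mulr1.
by case: (M i j) => -[|[|]] // lt; apply: val_inj.
Qed.

(* Mod 2, this is a square root of the characteristic polynomial (times X when n is odd):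
   a skew matrix gives an even or odd polynomial, and squaring is additive mod 2. *)
Definition half_char_poly n (S : 'M[int]_n) := even_poly (char_poly S * 'X^(odd n)).

Lemma size_char_polyMXn n (S : 'M[int]_n) :
  size (char_poly S * 'X^(odd n)) = (uphalf n).*2.+1.
Proof.
rewrite size_Mmonic ?monicXn ?monic_neq0 ?char_poly_monic // size_char_poly size_polyXn.
by rewrite uphalf_half doubleD addSn /= addnS /= addnC -{2}(odd_double_half n); case: (odd n); lia.
Qed.

Lemma size_half_char_poly n (S : 'M[int]_n) : size (half_char_poly S) = (uphalf n).+1.
Proof.
by rewrite size_even_poly_eq size_char_polyMXn /= ?odd_double // doubleK.
Qed.

Lemma half_char_poly_monic n (S : 'M[int]_n) : half_char_poly S \is monic.
Proof.
rewrite monicE lead_coefE size_half_char_poly coef_even_poly.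
have : char_poly S * 'X^(odd n) \is monic by rewrite monicMl ?monicXn ?char_poly_monic.
by rewrite monicE lead_coefE size_char_polyMXn.
Qed.

Lemma F2_intr_eq0 (x : int) : (x%:~R == 0 :> 'F_2) = (2 %| x)%Z.
Proof. by rewrite (dvdz_pcharf (pchar_Fp (isT : prime 2))). Qed.

(** Mod 2 a skew matrix is symmetric, hence so is [M]; its square is phi(S), times S in odd order,
    and vanishes by Cayley-Hamilton. *)
Lemma half_char_poly_ones n (S : 'M[int]_n.+1) i :
  S^T = - S -> (2 %| (horner_mx S (half_char_poly S) *m ones n.+1) i ord0)%Z.
Proof.
move=> skS; pose f : {rmorphism int -> 'F_2} := intr; pose S2 := map_mx f S.
pose g := half_char_poly S; pose M := horner_mx S2 (map_poly f g).
have oppF2 (x : 'F_2) : - x = x by case: x => -[|[|]] // lt; apply: val_inj.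
have S2_sym : S2^T = S2.
  by apply/matrixP => k l; have /matrixP/(_ k l) := skS; rewrite !mxE => ->; rewrite rmorphN oppF2.
have M_sym : M^T = M.
  have hT (p : {poly 'F_2}) : (horner_mx S2 p)^T = horner_mx S2 p.
    elim/poly_ind: p => [|p c IHp]; first by rewrite rmorph0 trmx0.
    rewrite rmorphD rmorphM /= horner_mx_X horner_mx_C linearD /= tr_scalar_mx trmx_mul.
    by rewrite IHp S2_sym; congr (_ + _); apply: comm_mx_horner.
  exact: hT.
have sqr_g : map_poly f g ^+ 2 = map_poly f (char_poly S * 'X^(odd n.+1)).
  have -> : map_poly f g = even_poly (map_poly f (char_poly S * 'X^(odd n.+1))).
    by apply/polyP => k; rewrite coef_even_poly !coef_map coef_even_poly.
  apply: sqr_even_polyF2 => k odd_k; rewrite coef_map coefMXn; case: ltnP => [_|le_k].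
    by rewrite /= rmorph0.
  by rewrite coef_char_poly_skew ?rmorph0 // oddB // odd_k oddb; case: (odd n.+1).
have M_sqr : M *m M = 0.
  rewrite [LHS](_ : _ = M ^+ 2) // -rmorphXn sqr_g rmorphM /= rmorphM /= map_char_poly.
  by rewrite Cayley_Hamilton mul0r.
rewrite -F2_intr_eq0; have /colP/(_ i) := F2_sym_sqr0 M_sym M_sqr.
rewrite /M -map_horner_mx; rewrite !mxE => <-; rewrite rmorph_sum /=; apply/eqP/eq_bigr => j _.
by rewrite rmorphM /= !mxE.
Qed.

Definition poly_walk_mx n (S : 'M[int]_n.+1) (z : nat -> {poly int}) : 'M[int]_n.+1 :=
  \matrix_(i, j) (horner_mx S (z j) *m ones n.+1) i 0.

(** The change of basis [U] from the powers of X to [z] is triangular with ones on the diagonal. *)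
Lemma det_poly_walk_mx n (S : 'M[int]_n.+1) (z : nat -> {poly int}) :
  (forall j, z j \is monic) -> (forall j, (j < n.+1)%N -> size (z j) = j.+1) ->
  \det (poly_walk_mx S z) = \det (walk_mx S).
Proof.
move=> z_monic sz; pose U : 'M_n.+1 := \matrix_(i, j) (z j)`_i.
have -> : poly_walk_mx S z = walk_mx S *m U.
  apply/matrixP => i j; rewrite [LHS]mxE.
  have {1}-> : z j = \poly_(k < n.+1) (z j)`_k.
    apply/polyP => k; rewrite coef_poly; case: ltnP => // le_k.
    by rewrite nth_default // sz // (leq_trans (ltn_ord j)).
  rewrite poly_def raddf_sum /= mulmx_suml summxE [RHS]mxE; apply: eq_bigr => k _.
  rewrite linearZ /= rmorphXn /= horner_mx_X -scalemxAl [LHS]mxE mulrC.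
  by rewrite [walk_mx _ _ _]mxE [U k j]mxE.
suff detU : \det U = 1 by rewrite det_mulmx detU mulr1.
rewrite -det_tr det_trig; last first.
  by apply/is_trig_mxP => i j lt_ij; rewrite !mxE nth_default // sz.
rewrite big1 // => i _; rewrite !mxE.
by have /monicP := z_monic i; rewrite lead_coefE sz.
Qed.

(** The conclusion says that m Q is integral, so for odd [m] that Q is integral at 2. In the basis
    [z] both walk matrices have a right factor [E], which carries the power of 2; the cofactor [YS]
    has determinant [m], and Q maps it to [YT]. *)
Lemma transport_2adic n (S T : 'M[int]_n.+1) (m : int) :
  S^T = - S -> T^T = - T -> char_poly S = char_poly T ->
  \det (walk_mx S) != 0 -> \det (walk_mx S) = 2 ^+ n.+1./2 * m ->
  exists Y, m *: (walk_mx T *m \adj (walk_mx S)) = \det (walk_mx S) *: Y.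
Proof.
move=> skS skT eST d0 dE; pose g := half_char_poly S; pose h := uphalf n.+1.
have gT : g = half_char_poly T by rewrite /g /half_char_poly eST.
(* As [g] has degree [h], each [z j] with [j <= n] has degree [j]; from [h] on, the factor [g] makes
   the columns even. *)
pose z j := if (j < h)%N then 'X^j else 'X^(j - h) * g.
have z_monic j : z j \is monic.
  by rewrite /z; case: ifP => _; rewrite ?monicXn // monicMl ?monicXn ?half_char_poly_monic.
have sz j : (j < n.+1)%N -> size (z j) = j.+1.
  move=> lt_jn; rewrite /z; case: ltnP => [_|le_j]; first by rewrite size_polyXn.
  rewrite size_monicM ?monicXn ?monic_neq0 ?half_char_poly_monic //.
  by rewrite size_polyXn size_half_char_poly -/h; lia.
pose E : 'M[int]_n.+1 := diag_mx (\row_j (if (j < h)%N then 1 else 2)).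
have half_walk (A : 'M_n.+1) : A^T = - A -> g = half_char_poly A ->
    exists Y, poly_walk_mx A z = Y *m E.
  move=> skA gA.
  exists (\matrix_(i, j) ((poly_walk_mx A z) i j %/ (if (j < h)%N then 1 else 2))%Z).
  apply/matrixP => i j; rewrite mul_mx_diag [RHS]mxE [X in X * _]mxE [X in _ * X]mxE.
  rewrite divzK // mxE /z.
  case: ifP => _; first by rewrite dvd1z.
  rewrite rmorphM -mulmxA mxE gA; apply: rpred_sum => k _; apply: dvdz_mull.
  exact: half_char_poly_ones.
have detE : \det E = 2 ^+ n.+1./2.
  rewrite det_diag; under eq_bigr do rewrite mxE.
  rewrite -(big_mkord xpredT (fun j => if (j < h)%N then 1 else 2 : int)).
  rewrite (@big_cat_nat _ _ _ h) //=; last first.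
    by rewrite /h uphalf_half -{3}(odd_double_half n.+1); lia.
  rewrite big_nat_cond big1 ?mul1r => [|j /andP[/andP[_ ->]]] //.
  rewrite big_nat_cond (eq_bigr (fun=> 2)); last first.
    by move=> j /andP[/andP[]]; rewrite leqNgt => /negPf ->.
  rewrite -big_nat_cond prodr_const_nat; congr (_ ^+ _).
  by rewrite /h uphalf_half -{1}(odd_double_half n.+1); lia.
have [YS eYS] := half_walk S skS erefl; have [YT eYT] := half_walk T skT gT.
have detE0 : \det E != 0 by rewrite detE expf_neq0.
have detYS : \det YS = m.
  apply: (mulIf detE0); rewrite -det_mulmx -eYS det_poly_walk_mx // dE detE mulrC.
  by [].
exists (YT *m \adj YS); set N := walk_mx T *m _.
have NY : N *m YS = \det (walk_mx S) *: YT.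
  apply: (mulmx_det_injr detE0); rewrite -mulmxA -eYS -scalemxAl -eYT.
  apply/matrixP => i j; have := transport_horner eST (z j).
  move/matrixP/(_ i 0); rewrite [in RHS]mxE => E1.
  rewrite [RHS]mxE [poly_walk_mx T z i j]mxE -E1 [LHS]mxE [RHS]mxE.
  by apply: eq_bigr => k _; rewrite [poly_walk_mx S z _ _]mxE.
by rewrite [RHS]scalemxAl -NY -mulmxA mul_mx_adj detYS mul_mx_scalar.
Qed.

(** * Odd primes dividing the determinant exactly once *)

Lemma dvdz_primeM (p : nat) (a b : int) :
  prime p -> (p %| a * b)%Z = (p %| a)%Z || (p %| b)%Z.
Proof. by move=> pp; rewrite !dvdzE abszM Euclid_dvdM. Qed.

(** The expression is an entry mod p^2 of the Gram matrix of [a *m v + p *: X], with [s] for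
    [v *m v^T] and [x] for [X *m v^T]. Mod [p] it forces [s] to vanish; after division by [p], an
    index where [a] is invertible gives x = -c a / 2 mod [p]. *)
Lemma isotropic_lift I (p : nat) (s : int) (a x : I -> int) :
  prime p -> odd p -> (exists i, ~~ (p %| a i)%Z) ->
  (forall i j, (p%:Z ^+ 2 %| s * (a i * a j) + p%:Z * (a i * x j + x i * a j))%Z) ->
  exists2 c, s = p%:Z * c & forall j, (p %| c * a j + 2 * x j)%Z.
Proof.
move=> pp p_odd [i pNa] psq; have p0 : p%:Z != 0 by case: p pp {pNa p_odd psq}.
have p_dvd2 : ~~ (p %| 2)%Z.
  by rewrite dvdzE /= dvdn_prime2 //; apply: contraL p_odd => /eqP ->.
have p_dvd_s : (p %| s)%Z.
  have : (p %| s * (a i * a i))%Z.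
    rewrite -[s * _](addrK (p%:Z * (a i * x i + x i * a i))) rpredB ?dvdz_mulr //.
    by apply: dvdz_trans (psq i i); rewrite expr2 dvdz_mulr.
  by rewrite !dvdz_primeM // !(negPf pNa) !orbF.
have /dvdzP[c sE] := p_dvd_s; exists c; first by rewrite sE mulrC.
have pdiv j k : (p %| c * (a j * a k) + (a j * x k + x j * a k))%Z.
  by have := psq j k; rewrite sE [c * _]mulrC -mulrA -mulrDr expr2 dvdz_mul2l //.
have pi : (p %| c * a i + 2 * x i)%Z.
  have := pdiv i i.
  have -> : c * (a i * a i) + (a i * x i + x i * a i) = a i * (c * a i + 2 * x i) by ring.
  by rewrite dvdz_primeM // (negPf pNa).
move=> j; have : (p %| a i * (c * a j + 2 * x j))%Z.
  have -> : a i * (c * a j + 2 * x j) =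
    2 * (c * (a i * a j) + (a i * x j + x i * a j)) - a j * (c * a i + 2 * x i) by ring.
  by rewrite rpredB // dvdz_mull.
by rewrite dvdz_primeM // (negPf pNa).
Qed.

(** Both lifts are governed by the same [c = s / p]: with x = -c a / 2 and y = -c b / 2 the cross
    term cancels. *)
Lemma isotropic_lift_cross I (p : nat) (s : int) (a x b y : I -> int) :
  prime p -> odd p ->
  (exists i, ~~ (p %| a i)%Z) -> (exists i, ~~ (p %| b i)%Z) ->
  (forall i j, (p%:Z ^+ 2 %| s * (a i * a j) + p%:Z * (a i * x j + x i * a j))%Z) ->
  (forall i j, (p%:Z ^+ 2 %| s * (b i * b j) + p%:Z * (b i * y j + y i * b j))%Z) ->
  forall i j, (p%:Z ^+ 2 %| s * (a i * b j) + p%:Z * (a i * y j + x i * b j))%Z.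
Proof.
move=> pp p_odd pNa pNb psqa psqb i j; have p0 : p%:Z != 0 by case: p pp {pNa pNb p_odd psqa psqb}.
have p_dvd2 : ~~ (p %| 2)%Z.
  by rewrite dvdzE /= dvdn_prime2 //; apply: contraL p_odd => /eqP ->.
have [c sE pa] := isotropic_lift pp p_odd pNa psqa.
have [c'] := isotropic_lift pp p_odd pNb psqb; rewrite sE => /(mulfI p0) <- pb.
rewrite -mulrA -mulrDr expr2 dvdz_mul2l //.
have : (p %| 2 * (c * (a i * b j) + (a i * y j + x i * b j)))%Z.
  have -> : 2 * (c * (a i * b j) + (a i * y j + x i * b j)) =
    a i * (c * b j + 2 * y j) + b j * (c * a i + 2 * x i) by ring.
  by rewrite rpredD // dvdz_mull.
by rewrite dvdz_primeM // (negPf p_dvd2).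
Qed.

(** In Smith normal form at most one diagonal entry is divisible by [p], so mod [p] the left kernel
    of [W] is at most a line, spanned by [v]. *)
Lemma rank1_mod_prime n (W : 'M[int]_n) (p : nat) :
  prime p -> ~~ (p%:Z ^+ 2 %| \det W)%Z ->
  exists v : 'rV[int]_n, forall k (N : 'M[int]_(k, n)),
    (forall i j, (p %| (N *m W) i j)%Z) -> exists a X, N = a *m v + p%:Z *: X.
Proof.
move=> pp pW; have [L L_unit [R R_unit [d _ WE]]] := int_Smith_normal_form W.
pose Dl := \row_(j < n) d`_j; have {}WE : W = L *m diag_mx Dl *m R.
  by rewrite WE; congr (_ *m _ *m _); apply/matrixP => i j; rewrite !mxE.
have NL k (N : 'M[int]_(k, n)) : (forall i j, (p %| (N *m W) i j)%Z) ->
    forall i j, (p %| (N *m L) i j * d`_j)%Z.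
  move=> pN i j; have -> : (N *m L) i j * d`_j = (N *m W *m invmx R) i j.
    by rewrite WE !mulmxA mulmxK // mul_mx_diag !mxE.
  by rewrite mxE; apply: rpred_sum => l _; rewrite dvdz_mulr.
have [v vP] : exists v : 'rV[int]_n, forall k (N : 'M[int]_(k, n)),
    (forall i j, (p %| (N *m L) i j * d`_j)%Z) -> exists a X, N *m L = a *m v + p%:Z *: X.
  have [j0 pj0|pNd] := pickP (fun j : 'I_n => (p %| d`_j)%Z); last first.
    (* No diagonal entry is divisible by [p]: the matrix vanishes mod [p]. *)
    exists 0 => k N; move: (N *m L) => P pP; exists 0, (\matrix_(i, j) (P i j %/ p)%Z).
    rewrite mulmx0 add0r; apply/matrixP => i j; rewrite !mxE mulrC divzK //.
    by have := pP i j; rewrite dvdz_primeM // pNd orbF.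
  exists (delta_mx 0 j0) => k N; move: (N *m L) => P pP.
  exists (col j0 P), (\matrix_(i, j) (if j == j0 then 0 else P i j %/ p)%Z).
  apply/matrixP => i j; rewrite !mxE big_ord1 !mxE eqxx /=.
  have [-> | ne_j] := eqVneq j j0; first by rewrite mulr1 mulr0 addr0.
  rewrite mulr0 add0r mulrC divzK //; have := pP i j; rewrite dvdz_primeM //.
  (* A second diagonal entry divisible by [p] would put p^2 into the determinant. *)
  case/orP => // pj; case/negP: pW; rewrite WE !det_mulmx det_diag.
  rewrite dvdz_mulr // dvdz_mull // (bigD1 j0) //= (bigD1 j) //= !mxE mulrA expr2.
  by rewrite dvdz_mulr // dvdz_mul.
exists (v *m invmx L) => k N /NL/vP [a [X NE]]; exists a, (X *m invmx L).
by rewrite -[N in LHS](mulmxK L_unit) NE mulmxDl -scalemxAl mulmxA.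
Qed.

Lemma dvdz_local (a x : int) : a != 0 ->
  (forall p : nat, prime p -> exists2 c, ~~ (p %| c)%Z & (a %| c * x)%Z) -> (a %| x)%Z.
Proof.
move=> a0 loc; rewrite dvdzE; apply/dvdn_partP; first by rewrite absz_gt0.
move=> p; rewrite inE /= mem_primes => /andP[pp _]; have [c pc] := loc p pp.
rewrite dvdzE abszM => /(dvdn_trans (dvdn_part p _)).
by rewrite Gauss_dvdr // p_part coprimeXl // prime_coprime.
Qed.

(** For N = d Q and a prime [p] dividing d exactly once, this says that Q is not integral at [p]. *)
Definition nonzero_mod m n (p : nat) (A : 'M[int]_(m, n)) : bool :=
  [exists ij : 'I_m * 'I_n, ~~ (p %| A ij.1 ij.2)%Z].

Lemma nonzero_modP m n (p : nat) (A : 'M[int]_(m, n)) :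
  reflect (exists i j, ~~ (p %| A i j)%Z) (nonzero_mod p A).
Proof.
apply: (iffP existsP) => [[[i j] pij] | [i [j pij]]]; first by exists i, j.
by exists (i, j).
Qed.

Lemma nonzero_modPn m n (p : nat) (A : 'M[int]_(m, n)) :
  ~~ nonzero_mod p A -> forall i j, (p %| A i j)%Z.
Proof. by move=> A0 i j; apply/negPn; apply: contra A0 => pij; apply/nonzero_modP; exists i, j. Qed.

Lemma gram_rank1 n k l (a : 'cV[int]_k) (b : 'cV_l) (v : 'rV_n) (X : 'M_(k, n))
    (Y : 'M_(l, n)) (p : int) i j :
  ((a *m v + p *: X) *m (b *m v + p *: Y)^T) i j =
  (v *m v^T) 0 0 * (a i 0 * b j 0) +
    p * (a i 0 * (Y *m v^T) j 0 + (X *m v^T) i 0 * b j 0) + p ^+ 2 * (X *m Y^T) i j.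
Proof.
have -> : (a *m v + p *: X) *m (b *m v + p *: Y)^T =
    a *m ((v *m v^T) *m b^T) + p *: (a *m (Y *m v^T)^T) + p *: ((X *m v^T) *m b^T)
    + p ^+ 2 *: (X *m Y^T).
  rewrite linearD linearZ /= mulmxDl !mulmxDr !trmx_mul !trmxK -!scalemxAl -!scalemxAr.
  by rewrite scalerA expr2 !mulmxA !addrA.
by rewrite !mxE !big_ord1 !mxE !big_ord1 !mxE; ring.
Qed.

Lemma isotropic_gram n k (p : nat) (v : 'rV[int]_n) (a b : 'cV[int]_k) (X Y : 'M_(k, n)) :
  prime p -> odd p ->
  let N1 := a *m v + p%:Z *: X in let N2 := b *m v + p%:Z *: Y in
  nonzero_mod p N1 -> nonzero_mod p N2 ->
  (forall i j, (p%:Z ^+ 2 %| (N1 *m N1^T) i j)%Z) ->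
  (forall i j, (p%:Z ^+ 2 %| (N2 *m N2^T) i j)%Z) ->
  forall i j, (p%:Z ^+ 2 %| (N1 *m N2^T) i j)%Z.
Proof.
move=> pp p_odd /= N1p N2p psq1 psq2 i j.
have nz (c : 'cV[int]_k) (Z : 'M_(k, n)) :
    nonzero_mod p (c *m v + p%:Z *: Z) -> exists i, ~~ (p %| c i ord0)%Z.
  case/nonzero_modP => [i' [j' nzij]]; exists i'; apply: contra nzij => pc.
  by rewrite !mxE big_ord1 rpredD ?dvdz_mulr.
have expand (c : 'cV[int]_k) (Z : 'M_(k, n)) :
    (forall i j, (p%:Z ^+ 2 %| ((c *m v + p%:Z *: Z) *m (c *m v + p%:Z *: Z)^T)%R i j)%Z) ->
    forall i j, (p%:Z ^+ 2 %| (v *m v^T)%R ord0 ord0 * (c i ord0 * c j ord0) +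
      p%:Z * (c i ord0 * (Z *m v^T)%R j ord0 + (Z *m v^T)%R i ord0 * c j ord0))%Z.
  move=> psq i' j'; have := psq i' j'; rewrite gram_rank1.
  by rewrite rpredDr // dvdz_mulr.
rewrite gram_rank1; apply: rpredD; last by rewrite dvdz_mulr.
exact: (isotropic_lift_cross pp p_odd (nz _ _ N1p) (nz _ _ N2p)
  (expand _ _ psq1) (expand _ _ psq2)).
Qed.

(** As N1 = d Q1 and N2 = d Q2, the conclusion says that R = Q1 Q2^T is integral. By [dvdz_local]
    this is checked prime by prime, up to a multiplier prime to [p]. *)
Lemma transport_gram_dvd n (S T1 T2 : 'M[int]_n.+1) (m : int) :
  let W := walk_mx S in let d := \det W in
  let N1 := walk_mx T1 *m \adj W in let N2 := walk_mx T2 *m \adj W in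
  S^T = - S -> T1^T = - T1 -> T2^T = - T2 ->
  char_poly S = char_poly T1 -> char_poly S = char_poly T2 ->
  W^T *m W = (walk_mx T1)^T *m walk_mx T1 -> W^T *m W = (walk_mx T2)^T *m walk_mx T2 ->
  d = 2 ^+ n.+1./2 * m -> ~~ (2 %| m)%Z -> squarefree m ->
  (forall p : nat, prime p -> odd p -> (p %| d)%Z ->
     nonzero_mod p N1 = nonzero_mod p N2) ->
  forall i j, (d ^+ 2 %| (N1 *m N2^T) i j)%Z.
Proof.
move=> W d N1 N2 skS sk1 sk2 e1 e2 g1 g2 dE m_odd m_sqf same i j.
have m0 : m != 0 by apply: contraNneq m_odd => ->.
have d0 : d != 0 by rewrite dE mulf_neq0 // expf_neq0.
apply: dvdz_local => [|p pp]; first by rewrite expf_neq0.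
have [p2 | p_odd] := even_prime pp.
  have [Y1 E1] := transport_2adic skS sk1 e1 d0 dE.
  have [Y2 E2] := transport_2adic skS sk2 e2 d0 dE.
  (* Both m Q1 and m Q2 are integral, and [m] is odd. *)
  exists (m ^+ 2); first by rewrite expr2 dvdz_primeM // p2 (negPf m_odd).
  have -> : m ^+ 2 * (N1 *m N2^T) i j = ((m *: N1) *m (m *: N2)^T) i j.
    by rewrite linearZ /= -scalemxAl -scalemxAr scalerA -expr2 [RHS]mxE.
  rewrite E1 E2 linearZ /= -scalemxAl -scalemxAr scalerA -expr2 mxE.
  exact: dvdz_mulr.
have [/dvdzP[d' dE'] | p_d] := boolP (p %| d)%Z; last first.
  exists (d ^+ 2); last exact: dvdz_mulr.
  by rewrite expr2 dvdz_primeM // negb_or p_d.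
have Np2m : ~~ (p%:Z ^+ 2 %| m)%Z.
  apply/negP => /m_sqf; case: p pp {same p_odd dE'} => [|[|p]] //.
have co2 k : coprimez (p%:Z ^+ 2) (2 ^+ k).
  by rewrite coprimezXl // coprimezXr // coprimezE /= coprimen2.
have Np2d : ~~ (p%:Z ^+ 2 %| d)%Z by rewrite dE Gauss_dvdzr.
have p0 : p%:Z != 0 by case: p pp {same p_odd dE' Np2m co2 Np2d}.
(* Here [d = d' * p] with [p] prime to [d'], so only divisibility by p^2 remains. *)
exists (d' ^+ 2).
  rewrite expr2 dvdz_primeM // orbb; apply: contra Np2d => pd'.
  by rewrite dE' expr2 dvdz_mul.
rewrite dE' exprMn dvdz_mul //.
(* The product is d times [walk_mx T], hence zero mod [p]; so mod [p] the rows of both matrices lie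
   on one line. *)
have NW T : forall i j, (p %| (walk_mx T *m \adj W *m W) i j)%Z.
  by move=> k l; rewrite -mulmxA mul_adj_mx mul_mx_scalar mxE -/d dE' -mulrA dvdz_mull // dvdz_mulr.
have [v rank1] := rank1_mod_prime pp Np2d.
have [a [X N1E]] := rank1 _ _ (NW T1); have [b [Y N2E]] := rank1 _ _ (NW T2).
have psq (N : 'M_n.+1) : N *m N^T = (d ^+ 2)%:M -> forall i j, (p%:Z ^+ 2 %| (N *m N^T) i j)%Z.
  move=> -> k l; rewrite mxE dE' exprMn.
  by case: (_ == _); rewrite ?mulr0n ?dvdz0 // mulr1n dvdz_mull.
have := same p pp p_odd; rewrite dE' dvdz_mull // => /(_ isT) same_p.
have [nz1 | z1] := boolP (nonzero_mod p N1).
  have nz2 : nonzero_mod p N2 by rewrite -same_p.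
  have := psq N1 (transportM_trmx d0 g1); have := psq N2 (transportM_trmx d0 g2).
  move: nz1 nz2; rewrite /N1 /N2 N1E N2E => nz1 nz2 q2 q1.
  exact: (isotropic_gram pp p_odd nz1 nz2 q1 q2).
(* Both factors vanish mod [p], so each term of the product is divisible by p^2. *)
have z2 : ~~ nonzero_mod p N2 by rewrite -same_p.
rewrite mxE; apply: rpred_sum => k _; rewrite expr2 [N2^T k j]mxE.
by rewrite dvdz_mul ?nonzero_modPn.
Qed.

(** * From integral orthogonal matrices to permutations *)

(** Each row has sum 1 and sum of squares 1, so the terms r (r - 1), nonnegative over the integers,
    add up to 0 and every entry is 0 or 1. Orthogonality of the rows makes [s] injective. *)
Lemma int_orthogonal_stochastic n (R : 'M[int]_n) :
  R *m R^T = 1%:M -> R *m ones n = ones n ->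
  exists s : {perm 'I_n}, forall i j, R i j = (j == s i)%:R.
Proof.
move=> RRT Re.
have sum1 i : \sum_j R i j = 1.
  transitivity ((R *m ones n) i 0); last by rewrite Re mxE.
  by rewrite mxE; apply: eq_bigr => j _; rewrite mxE mulr1.
have sqr1 i : \sum_j R i j * R i j = 1.
  transitivity ((R *m R^T) i i); last by rewrite RRT mxE eqxx.
  by rewrite mxE; apply: eq_bigr => j _; rewrite mxE.
have R01 i j : R i j = 0 \/ R i j = 1.
  have sum0 : \sum_j R i j * (R i j - 1) = 0.
    transitivity (\sum_j R i j * R i j - \sum_j R i j); last by rewrite sum1 sqr1.
    by rewrite -sumrB; apply: eq_bigr => k _; rewrite mulrBr mulr1.
  have := psumr_eq0P _ sum0 => /(_ _ j isT) E.
  have {}E : R i j * (R i j - 1) = 0 by apply: E => k _; nia.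
  by move/eqP: E; rewrite mulf_eq0 subr_eq0 => /orP[] /eqP; [left | right].
have R_ge0 i j : 0 <= R i j by case: (R01 i j) => ->.
have rowE i : exists j, forall k, R i k = (k == j)%:R.
  have [j /eqP Rij | no1] := pickP (fun j => R i j == 1); last first.
    have := sum1 i; rewrite big1 // => j _.
    by case: (R01 i j) => // Rij; have := no1 j; rewrite Rij eqxx.
  exists j => k; have [-> // | kj] := eqVneq k j.
  have := sum1 i; rewrite (bigD1 j) //= Rij -[RHS]addr0 => /addrI /psumr_eq0P -> //.
have [s sE] := fin_all_exists rowE.
have s_inj : injective s.
  move=> i i' eq_s; have /matrixP/(_ i i') := RRT; rewrite !mxE (bigD1 (s i)) //= mxE !sE eq_s eqxx.
  rewrite big1 => [|k ne_k]; last by rewrite sE eq_s (negPf ne_k) mul0r.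
  by case: eqVneq.
by exists (perm s_inj) => i j; rewrite sE permE.
Qed.

(** By skewness [N2^T] intertwines in the opposite direction to [N2], so [R] intertwines [T2] and
    [T1]; it is also orthogonal and fixes e. *)
Lemma transport_perm n (S T1 T2 N1 N2 : 'M[int]_n) (d : int) :
  d != 0 -> S^T = - S -> T2^T = - T2 -> N1 *m S = T1 *m N1 -> N2 *m S = T2 *m N2 ->
  N1 *m N1^T = (d ^+ 2)%:M -> N2^T *m N2 = (d ^+ 2)%:M ->
  N1 *m ones n = d *: ones n -> N2^T *m ones n = d *: ones n ->
  (forall i j, (d ^+ 2 %| (N1 *m N2^T) i j)%Z) ->
  exists s : {perm 'I_n}, forall i j, T1 i j = T2 (s i) (s j).
Proof.
move=> d0 skS sk2 NS1 NS2 O1 O2 e1 e2 dvdN; have d20 : d ^+ 2 != 0 by rewrite expf_neq0.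
have [R NE] : exists R, N1 *m N2^T = d ^+ 2 *: R.
  exists (\matrix_(i, j) ((N1 *m N2^T)%R i j %/ d ^+ 2)%Z); move: dvdN; move: (N1 *m _) => P dvdP.
  by apply/matrixP => i j; rewrite !mxE mulrC divzK.
have NEt : N2 *m N1^T = d ^+ 2 *: R^T by rewrite -[N2]trmxK -trmx_mul NE linearZ.
have RR : R *m R^T = 1%:M.
  apply: (scale_mx_inj d20); apply: (scale_mx_inj d20).
  rewrite scalemxAl -NE scalemxAr -NEt mulmxA -(mulmxA N1) O2.
  by rewrite mul_mx_scalar -scalemxAl O1 -scalemx1.
have Re : R *m ones n = ones n.
  by apply: (scale_mx_inj d20); rewrite scalemxAl -NE -mulmxA e2 -scalemxAr e1 scalerA expr2.
have NS2t : S *m N2^T = N2^T *m T2.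
  by apply: oppr_inj; rewrite -mulNmx -skS -mulmxN -sk2 -!trmx_mul NS2.
have RT : R *m T2 = T1 *m R.
  apply: (scale_mx_inj d20).
  by rewrite scalemxAl -NE -mulmxA -NS2t mulmxA NS1 -mulmxA NE scalemxAr.
have [s sE] := int_orthogonal_stochastic RR Re; exists s => i j.
(* At [(i, s j)] one term survives on each side: [T2 (s i) (s j)] and [T1 i j]. *)
have /matrixP/(_ i (s j)) := RT; rewrite !mxE (bigD1 (s i)) //= sE eqxx mul1r.
rewrite big1 => [|k ne_k]; last first.
  by rewrite sE (negPf ne_k) mul0r.
rewrite addr0 (bigD1 j) //= sE eqxx mulr1 big1 ?addr0 => [|k ne_k] //.
by rewrite sE (inj_eq perm_inj) eq_sym (negPf ne_k) mulr0.
Qed.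

(** * Oriented graphs and the count of classes *)

Lemma skew_adj_trmx n (D : ograph n) : (skew_adj D)^T = - skew_adj D.
Proof.
have /forallP D_or := arcs_oriented D.
apply/matrixP => i j; rewrite !mxE.
have {D_or} /implyP : Defs.arc D i j ==> ~~ Defs.arc D j i by have /forallP/(_ j) := D_or i.
by case: (Defs.arc D i j); case: (Defs.arc D j i) => //= /(_ isT).
Qed.

Lemma skew_adj_eq1 n (D : ograph n) i j : (skew_adj D i j == 1) = Defs.arc D i j.
Proof. by rewrite mxE; case: (Defs.arc D i j) => //; case: (Defs.arc D j i). Qed.

Lemma oisom_sym n (D C : ograph n) : oisom D C -> oisom C D.
Proof.
case/existsP => s /forallP Ds; apply/existsP; exists s^-1%g; apply/forallP => i; apply/forallP => j.
by have /forallP/(_ (s^-1%g j)) := Ds (s^-1%g i); rewrite !permKV eq_sym.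
Qed.

Lemma oisom_trans n (D C B : ograph n) : oisom D C -> oisom C B -> oisom D B.
Proof.
case/existsP => s /forallP Ds /existsP[t /forallP Ct]; apply/existsP; exists (s * t)%g.
apply/forallP => i; apply/forallP => j; rewrite !permM.
have /forallP/(_ j)/eqP-> := Ds i; exact: (forallP (Ct (s i))).
Qed.

Lemma isom_class_eq n (C1 C2 : ograph n) : oisom C1 C2 -> isom_class C1 = isom_class C2.
Proof.
move=> C12; apply/setP => B; rewrite !inE; apply/idP/idP; last exact: oisom_trans.
exact: (oisom_trans (oisom_sym C12)).
Qed.

Lemma eigenvalues_char_poly n (A B : 'M[int]_n) :
  perm_eq (eigenvalues A) (eigenvalues B) -> char_poly A = char_poly B.
Proof.
move=> eAB; have : char_poly (map_mx intr A : 'M[algC]_n) = char_poly (map_mx intr B : 'M[algC]_n).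
  by rewrite !char_poly_eigenvalues; apply: perm_big.
rewrite -!map_char_poly => /polyP eqc; apply/polyP => k.
by have := eqc k; rewrite !coef_map; apply: intr_inj.
Qed.

Lemma same_gen_skew_spectrum_refl n (D : ograph n) : same_gen_skew_spectrum D D.
Proof. by rewrite /same_gen_skew_spectrum !perm_refl. Qed.

(* [det W(D)] times the rational orthogonal matrix [Q] with [Q W(D) = W(C)]. *)
Definition transport n (D C : ograph n) : 'M[int]_n := skew_walk C *m \adj (skew_walk D).

Lemma in_F_det n (D : ograph n) : in_F D -> exists m,
  [/\ \det (skew_walk D) = 2 ^+ n./2 * m, ~~ (2 %| m)%Z & squarefree m].
Proof.
case=> m [dE m_odd m_sqf]; exists m; split=> //; apply: (@intr_inj rat).
by rewrite rmorphM rmorphXn /= -dE mulrC divfK // expf_neq0.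
Qed.

Lemma oisom_of_transport n (D C1 C2 : ograph n.+1) :
  in_F D -> same_gen_skew_spectrum C1 D -> same_gen_skew_spectrum C2 D ->
  (forall p : nat, prime p -> odd p -> (p %| \det (skew_walk D))%Z ->
     nonzero_mod p (transport D C1) = nonzero_mod p (transport D C2)) ->
  oisom C1 C2.
Proof.
move=> /in_F_det[m [dE m_odd m_sqf]].
case/andP=> /eigenvalues_char_poly/esym e1 /eigenvalues_char_poly/esym eJ1.
case/andP=> /eigenvalues_char_poly/esym e2 /eigenvalues_char_poly/esym eJ2 same.
have m0 : m != 0 by apply: contraNneq m_odd => ->.
have d0 : \det (skew_walk D) != 0 by rewrite dE mulf_neq0 // expf_neq0.
have d20 : \det (skew_walk D) ^+ 2 != 0 by rewrite expf_neq0.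
have skD := skew_adj_trmx D; have sk1 := skew_adj_trmx C1; have sk2 := skew_adj_trmx C2.
have g1 := skew_walk_gram skD sk1 e1 eJ1; have g2 := skew_walk_gram skD sk2 e2 eJ2.
have dvdN := transport_gram_dvd skD sk1 sk2 e1 e2 g1 g2 dE m_odd m_sqf same.
have [s sE] := transport_perm d0 skD sk2 (transport_intertwines d0 e1)
  (transport_intertwines d0 e2) (transportM_trmx d0 g1) (transport_trmxM g2)
  (transport_ones e1) (transport_trmx_ones d0 e2 g2) dvdN.
apply/existsP; exists s; apply/forallP => i; apply/forallP => j.
by rewrite -!skew_adj_eq1 sE.
Qed.

Theorem theorem1 (n : nat) (hn : (1 <= n)%N) (D : ograph n) (hD : in_F D) :
  (#|[set isom_class C | C in gen_cospectral_mates D]|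
     <= 2 ^ num_odd_prime_factors (\det (skew_walk D)) - 1)%N.
Proof.
case: n hn D hD => [//|n] _ D hD; set d := \det (skew_walk D).
have d0 : d != 0.
  have [m [dE m_odd _]] := in_F_det hD; rewrite /d dE mulf_neq0 ?expf_neq0 //.
  by apply: contraNneq m_odd => ->.
pose ps := [seq p <- primes `|d|%N | odd p]; pose k := size ps.
(* [F C] records the odd primes dividing [d] at which Q is not integral. *)
pose F C := [set i : 'I_k | nonzero_mod (nth 0%N ps i) (transport D C)].
have F_iso C1 C2 : same_gen_skew_spectrum C1 D -> same_gen_skew_spectrum C2 D ->
    F C1 = F C2 -> oisom C1 C2.
  move=> sp1 sp2 eqF; apply: (oisom_of_transport hD sp1 sp2) => p pp p_odd p_d.
  have p_ps : p \in ps.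
    by rewrite mem_filter p_odd mem_primes pp absz_gt0 d0; move: p_d; rewrite dvdzE.
  have ip : (index p ps < k)%N by rewrite index_mem.
  by have /setP/(_ (Ordinal ip)) := eqF; rewrite !inE nth_index.
(* For D itself the transport is the scalar matrix [d]. *)
have F_D : F D = set0.
  apply/setP => i; rewrite !inE; apply/negbTE/negP => /nonzero_modP[a [b /negP[]]].
  have : nth 0%N ps i \in ps by rewrite mem_nth.
  rewrite mem_filter mem_primes => /and3P[_ _ /andP[_ pd]].
  by rewrite /transport mul_mx_adj mxE; case: (_ == _); rewrite ?mulr0n ?dvdz0 // mulr1n dvdzE.
(* [G] inverts [F] on classes; [set0] is a default for sets of primes that no mate attains. *)
pose G (A : {set 'I_k}) : {set ograph n.+1} :=
  if [pick C in gen_cospectral_mates D | F C == A] is Some C then isom_class C else set0.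
(* A mate with empty [F] would be isomorphic to D; excluding the empty set of primes gives the -1 in
   the bound. *)
have sub : [set isom_class C | C in gen_cospectral_mates D] \subset G @: [set~ set0].
  apply/subsetP => _ /imsetP[C mateC ->]; apply/imsetP; exists (F C).
    rewrite !inE; apply: contraTneq mateC => FC0; rewrite inE negb_and negbK.
    have [sp|] := boolP (same_gen_skew_spectrum C D); rewrite ?orbT // orbF.
    by apply: F_iso sp _ _; rewrite ?same_gen_skew_spectrum_refl // F_D.
  rewrite /G; case: pickP => [B /andP[mateB /eqP FBC]|/(_ C)]; last by rewrite mateC eqxx.
  apply: isom_class_eq; move: mateC mateB; rewrite !inE => /andP[_ spC] /andP[_ spB].
  exact: F_iso.
apply: leq_trans (subset_leq_card sub) (leq_trans (leq_imset_card _ _) _).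
by rewrite cardsC1 -cardsT -powersetT card_powerset cardsT card_ord subn1.
Qed.
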